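(* Let $n\ge 3$ and let $i$ be a vertex of the cycle $C_n$. The nullity pairs other than $(0,0)$, $(1,0)$, $(0,1)$ that $(C_n,i)$ allows with the SNIP are precisely $(1,1)$ and $(2,1)$. Moreover, every matrix in $\mathcal{S}(C_n)$ has the $i$-SNIP.
   Context: All matrices are real. For a simple graph $G$ on $[n]$, $\mathcal{S}(G)$ is the set of real symmetric $n\times n$ matrices whose off-diagonal $(j,k)$ entry is nonzero iff $\{j,k\}\in E(G)$ (diagonal free). $A(i)$ is $A$ with row and column $i$ deleted. $A$ has the $i$-SNIP if $X=O$ is the only real symmetric $X$ with $A\circ X=O$, $I\circ X=O$ and $(AX)(i,:]=O$ ($AX$ with row $i$ deleted). $(G,i)$ allows $(k,\ell)$ with the SNIP if some $A\in\mathcal{S}(G)$ with the $i$-SNIP has $(\operatorname{null}(A),\operatorname{null}(A(i)))=(k,\ell)$. *)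

(* Defs.v *)
From mathcomp Require Import all_boot all_order all_algebra.
From mathcomp Require Import reals.

Set Implicit Arguments.
Unset Strict Implicit.
Unset Printing Implicit Defensive.

Import GRing.Theory.
Local Open Scope ring_scope.

Record sgraph (n : nat) := SGraph {
  adj :> rel 'I_n;
  adj_sym : symmetric adj;
  adj_irrefl : irreflexive adj
}.

(* [ordS] is the cyclic successor j |-> j + 1 mod n. The conjunct j != k only
   matters for n = 1; for n >= 3 this is the cycle C_n. *)
Definition cycle_rel (n : nat) : rel 'I_n :=
  fun j k => (j != k) && ((ordS j == k) || (ordS k == j)).

Lemma cycle_rel_sym (n : nat) : symmetric (@cycle_rel n).
Proof. by move=> j k; rewrite /cycle_rel eq_sym orbC. Qed.

Lemma cycle_rel_irrefl (n : nat) : irreflexive (@cycle_rel n).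
Proof. by move=> j; rewrite /cycle_rel eqxx. Qed.

Definition cycle_graph (n : nat) : sgraph n :=
  SGraph (@cycle_rel_sym n) (@cycle_rel_irrefl n).

Section Matrices.

Variable R : realType.

Definition in_S (n : nat) (G : sgraph n) (A : 'M[R]_n) : Prop :=
  A^T = A /\ forall j k : 'I_n, j != k -> (A j k != 0 <-> G j k).

Definition hadamard (m n : nat) (A B : 'M[R]_(m, n)) : 'M[R]_(m, n) :=
  \matrix_(j, k) (A j k * B j k).

(* The columns of [cokermx A] span the null space {v | A v = 0}. *)
Definition nullity (n : nat) (A : 'M[R]_n) : nat := \rank (cokermx A).

Definition del_rc (n : nat) (i : 'I_n) (A : 'M[R]_n) : 'M[R]_n.-1 :=
  row' i (col' i A).

Definition has_SNIP (n : nat) (i : 'I_n) (A : 'M[R]_n) : Prop :=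
  forall X : 'M[R]_n,
    X^T = X -> hadamard A X = 0 -> hadamard 1%:M X = 0 ->
    row' i (A *m X) = 0 -> X = 0.

Definition allows_SNIP (n : nat) (G : sgraph n) (i : 'I_n) (p : nat * nat) :
    Prop :=
  exists A : 'M[R]_n,
    [/\ in_S G A, has_SNIP i A & (nullity A, nullity (del_rc i A)) = p].

End Matrices.

(* Main.v *)
Require Import Defs.
From mathcomp Require Import all_boot all_order all_algebra.
From mathcomp Require Import reals zify ring.

(** On a matrix A in S(C_n), the equations (A x)_j = 0 for j != i form a
    three-term recurrence along the path left after cutting the cycle at i, so
    x vanishes as soon as two cyclically consecutive entries do.  For the
    SNIP, column k of X vanishes at k and k + 1, hence X = 0.  For the
    nullities, a null vector of A(i), extended by 0 at i, is determined by its
    entry at i + 1, so null A(i) <= 1; and null A <= null A(i) + 1 because A(i)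
    is a submatrix of A.  The pair (2, 1) is realized by the weighted Laplacian
    of the cycle with weight 1 / (v_(p+1) - v_p) on the edge {p, p + 1}, where
    v_p = p: its kernel contains both the constant vector and v.  Adding 1 to
    its (i, i) entry keeps A(i) and lowers the nullity of A by one. *)

Set Implicit Arguments.
Unset Strict Implicit.
Unset Printing Implicit Defensive.

Section CycleNullity.

Import GRing.Theory Num.Theory.
Local Open Scope ring_scope.

(** * Rank and nullity bounds *)

Lemma rank_ge_of_kernel_meet (F : fieldType) (m n p : nat)
    (M : 'M[F]_(m, n)) (C : 'M[F]_(m, p)) :
  (forall u : 'rV_m, u *m M = 0 -> u *m C = 0 -> u = 0) ->
  (m <= \rank M + p)%N.
Proof.
(* The block matrix has trivial left kernel, hence rank [m], and the [p] columns of [C] account for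
   at most [p] of it. *)
move=> MC0; have : row_free (row_mx M C).
  apply: inj_row_free => v; rewrite mul_mx_row => /eqP.
  by rewrite row_mx_eq0 => /andP[/eqP vM /eqP vC]; apply: MC0.
rewrite -row_leq_rank => /leq_trans; apply.
rewrite -mxrank_tr tr_row_mx -addsmxE.
apply: leq_trans (mxrank_adds_leqif _ _).1 _.
by rewrite !mxrank_tr leq_add2l rank_leq_col.
Qed.

(** Multiplication by [row' i 1%:M] inserts a zero at position [i]; it extends vectors on the
    vertices other than [i] to the whole cycle. *)
Lemma mul_row'1_lift (F : fieldType) (n : nat) (i : 'I_n) (u : 'rV[F]_n.-1)
    (j : 'I_n.-1) : (u *m row' i 1%:M) 0 (lift i j) = u 0 j.
Proof.
rewrite mxE (bigD1 j) //= big1 ?addr0 => [|k kj].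
  by rewrite !mxE eqxx mulr1.
by rewrite !mxE (inj_eq lift_inj) (negPf kj) mulr0.
Qed.

Lemma mul_row'1_self (F : fieldType) (n : nat) (i : 'I_n) (u : 'rV[F]_n.-1) :
  (u *m row' i 1%:M) 0 i = 0.
Proof.
by rewrite mxE big1 // => k _; rewrite !mxE eq_sym (negPf (neq_lift i k)) mulr0.
Qed.

Lemma rank_del_rc (R : realType) (n : nat) (i : 'I_n) (A : 'M[R]_n) :
  (\rank (del_rc i A) <= \rank A)%N.
Proof.
rewrite /del_rc row'Esub (leq_trans (mxrankS (rowsub_sub _ _))) //.
by rewrite -mxrank_tr tr_col' row'Esub -(mxrank_tr A) mxrankS // rowsub_sub.
Qed.

Lemma nullityE (R : realType) (n : nat) (A : 'M[R]_n) :
  nullity A = (n - \rank A)%N.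
Proof. exact: mxrank_coker. Qed.

Lemma nullity_le_del_rc (R : realType) (n : nat) (i : 'I_n) (A : 'M[R]_n) :
  (nullity A <= (nullity (del_rc i A)).+1)%N.
Proof. by rewrite !nullityE; have := rank_del_rc i A; lia. Qed.

(** * Walking around the cycle *)

Lemma val_iter_ordS (n : nat) (i : 'I_n) (t : nat) :
  iter t (@ordS n) i = ((i + t) %% n)%N :> nat.
Proof.
elim: t => [|t IHt] /=; first by rewrite addn0 modn_small.
by rewrite IHt -addn1 modnDml addn1 addnS.
Qed.

Lemma iter_ordS_neq (n : nat) (i : 'I_n) (t : nat) :
  (0 < t < n)%N -> iter t (@ordS n) i != i.
Proof.
case/andP=> t0 tn; apply/eqP => /(congr1 val) /=; rewrite val_iter_ordS.
rewrite -[in RHS](modn_small (ltn_ord i)) -[in RHS](addn0 i) => /eqP.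
by rewrite eqn_modDl mod0n modn_small // eqn0Ngt t0.
Qed.

Lemma iter_ordS_surj (n : nat) (i s : 'I_n) :
  exists2 t, (t < n)%N & iter t (@ordS n) i = s.
Proof.
have n0 : (0 < n)%N by apply: leq_ltn_trans (ltn_ord i).
(* The distance from [i] to [s] is [s - i] modulo [n], written without truncated subtraction. *)
exists ((s + (n - i)) %% n)%N; first by rewrite ltn_mod.
apply: val_inj; rewrite /= val_iter_ordS modnDmr addnCA.
by rewrite subnKC ?(ltnW (ltn_ord i)) // modnDr modn_small.
Qed.

Lemma ordS_neq (n : nat) (j : 'I_n) : (3 <= n)%N -> ordS j != j.
Proof. by move=> n3; apply: (@iter_ordS_neq n j 1); lia. Qed.

Lemma ordS2_neq (n : nat) (j : 'I_n) : (3 <= n)%N -> ordS (ordS j) != j.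
Proof. by move=> n3; apply: (@iter_ordS_neq n j 2); lia. Qed.

(** * The three-term recurrence *)

Lemma cycle_mul_row (R : realType) (n : nat) (A : 'M[R]_n) (u : 'rV[R]_n)
    (p : 'I_n) : (3 <= n)%N -> in_S (cycle_graph n) A ->
  (u *m A) 0 (ordS p) =
    u 0 p * A p (ordS p) + u 0 (ordS p) * A (ordS p) (ordS p)
    + u 0 (ordS (ordS p)) * A (ordS (ordS p)) (ordS p).
Proof.
(* Column p + 1 of [A] vanishes outside p, p + 1 and p + 2, which are distinct because n >= 3. *)
move=> n3 [Asym AG]; rewrite mxE (bigD1 p) //= (bigD1 (ordS p)) ?ordS_neq //=.
rewrite (bigD1 (ordS (ordS p))) /=; last by rewrite ordS2_neq ?ordS_neq.
rewrite big1 ?addr0 ?addrA // => k /andP[/andP[kp kSp] kSSp].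
have [->|nz] := eqVneq (A k (ordS p)) 0; first by rewrite mulr0.
have := (AG _ _ kSp).1 nz; rewrite /= /cycle_rel kSp (inj_eq (@ordS_inj n)).
by rewrite (negPf kp) eq_sym (negPf kSSp).
Qed.

Lemma cycle_adj_neq0 (R : realType) (n : nat) (A : 'M[R]_n) (p : 'I_n) :
  (3 <= n)%N -> in_S (cycle_graph n) A ->
  A p (ordS p) != 0 /\ A (ordS p) p != 0.
Proof.
move=> n3 [Asym AG]; have pSp : p != ordS p by rewrite eq_sym ordS_neq.
suff h : A p (ordS p) != 0 by split=> //; rewrite -Asym mxE.
by apply/AG; rewrite //= /cycle_rel pSp eqxx.
Qed.

Lemma cycle_kernel_propagation (R : realType) (n : nat) (i s : 'I_n)
    (A : 'M[R]_n) (u : 'rV[R]_n) :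
  (3 <= n)%N -> in_S (cycle_graph n) A ->
  (forall j, j != i -> (u *m A) 0 j = 0) ->
  u 0 s = 0 -> u 0 (ordS s) = 0 -> u = 0.
Proof.
move=> n3 AG uA us uSs; pose e t := iter t (@ordS n) i; pose y t := u 0 (e t).
have rec t : (t.+1 < n)%N -> y t * A (e t) (e t.+1)
    + y t.+1 * A (e t.+1) (e t.+1) + y t.+2 * A (e t.+2) (e t.+1) = 0.
  by move=> tn; rewrite -(uA _ (iter_ordS_neq i (t := t.+1) tn)) cycle_mul_row.
have fwd t : (t.+1 < n)%N -> y t = 0 -> y t.+1 = 0 -> y t.+2 = 0.
  move=> tn y0 y1; move: (rec t tn); rewrite y0 y1 !mul0r !add0r.
  have [_ nz] := cycle_adj_neq0 (e t.+1) n3 AG.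
  by move/eqP; rewrite mulf_eq0 (negPf nz) orbF => /eqP.
have bwd t : (t.+1 < n)%N -> y t.+1 = 0 -> y t.+2 = 0 -> y t = 0.
  move=> tn y1 y2; move: (rec t tn); rewrite y1 y2 !mul0r !addr0.
  have [nz _] := cycle_adj_neq0 (e t) n3 AG.
  by move/eqP; rewrite mulf_eq0 (negPf nz) orbF => /eqP.
(* The two zeros may lie anywhere: they are carried back to the start of the walk, then forward over
   all of it. *)
have [y0 y1] : y 0%N = 0 /\ y 1%N = 0.
  have [t tn ts] := iter_ordS_surj i s.
  have : y t = 0 /\ y t.+1 = 0 by rewrite /y /e /= ts.
  elim: t tn {ts} => // t IHt tn [h1 h2]; apply: IHt; first exact: ltnW.
  by split=> //; apply: bwd.
have yt t : (t < n)%N -> y t = 0 /\ y t.+1 = 0.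
  elim: t => // t IHt tn; have [|h1 h2] := IHt; first exact: ltnW.
  by split=> //; apply: fwd.
apply/rowP => j; rewrite [RHS]mxE.
by have [t tn <-] := iter_ordS_surj i j; have [] := yt t tn.
Qed.

(** * The SNIP and the bound on the nullity of A(i) *)

Lemma cycle_SNIP (R : realType) (n : nat) (i : 'I_n) (A : 'M[R]_n) :
  (3 <= n)%N -> in_S (cycle_graph n) A -> has_SNIP i A.
Proof.
move=> n3 AG X Xsym AX IX AXi; have [Asym AE] := AG.
apply/row_matrixP => k; rewrite row0.
apply: (cycle_kernel_propagation (i := i) (s := k) n3 AG).
(* By symmetry X A is the transpose of A X, so entry [j] of (row [k] of X) A is entry (j, k) of A
   X. *)
- move=> j ji; rewrite -row_mul mxE -[X in X *m _]Xsym -[A]Asym -trmx_mul mxE.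
  have [j' ->|ij] := unliftP i j; last by rewrite ij eqxx in ji.
  by move/matrixP/(_ j' k): AXi; rewrite !mxE.
- by rewrite mxE; move/matrixP/(_ k k): IX; rewrite !mxE eqxx mul1r.
- rewrite mxE; move/matrixP/(_ k (ordS k)): AX; rewrite !mxE => /eqP.
  have [nz _] := cycle_adj_neq0 k n3 AG.
  by rewrite mulf_eq0 (negPf nz) => /eqP.
Qed.

Lemma cycle_nullity_del_rc (R : realType) (n : nat) (i : 'I_n) (A : 'M[R]_n) :
  (3 <= n)%N -> in_S (cycle_graph n) A -> (nullity (del_rc i A) <= 1)%N.
Proof.
move=> n3 AG; rewrite nullityE leq_subLR.
(* The single column [C] reads off the entry at i + 1 of the extension [w] of [u] by zero. *)
apply: (rank_ge_of_kernel_meet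
  (C := row' i (delta_mx (ordS i) 0 : 'cV_n))) => u uA uC.
pose w := u *m row' i 1%:M.
have wM p (B : 'M_(n, p)) : w *m B = u *m row' i B.
  by rewrite -mulmxA row'Esub mul_rowsub_mx mul1mx.
have w0 : w = 0.
  apply: (cycle_kernel_propagation (i := i) (s := i) n3 AG).
  - move=> j ji; have [j' ->|ij] := unliftP i j; last by rewrite ij eqxx in ji.
    rewrite wM; move/rowP/(_ j'): uA; rewrite !mxE => uA.
    by rewrite -[RHS]uA; apply: eq_bigr => k _; rewrite !mxE.
  - exact: mul_row'1_self.
  - move: uC; rewrite -wM => /rowP/(_ 0); rewrite -colE !mxE; exact.
by apply/rowP => j; rewrite -(mul_row'1_lift i) -/w w0 !mxE.
Qed.

(** * The weighted Laplacian *)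

Definition cycle_laplacian (R : realType) (n : nat) : 'M[R]_n :=
  \sum_(p < n) ((ordS p)%:R - p%:R)^-1 *:
    ((delta_mx p 0 - delta_mx (ordS p) 0 : 'cV[R]_n) *m
     (delta_mx 0 p - delta_mx 0 (ordS p))).

(** Edge weights only have to be nonzero: on the edge from n - 1 back to 0 the weight is
    negative. *)
Lemma ordS_natr_neq (R : realType) (n : nat) (p : 'I_n) :
  (3 <= n)%N -> (ordS p)%:R - p%:R != 0 :> R.
Proof. by move=> n3; rewrite subr_eq0 eqr_nat; apply: ordS_neq. Qed.

Lemma cycle_laplacianE (R : realType) (n : nat) (j k : 'I_n) : j != k ->
  cycle_laplacian R n j k =
    - (((ordS j)%:R - j%:R)^-1 *+ (ordS j == k)
       + ((ordS k)%:R - k%:R)^-1 *+ (ordS k == j)).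
Proof.
move=> jk; rewrite summxE.
pose w (p : 'I_n) : R := ((ordS p)%:R - p%:R)^-1.
transitivity (- (\sum_(p < n) ((w p *+ (ordS p == k)) *+ (p == j)
    + (w p *+ (ordS p == j)) *+ (p == k)))).
  rewrite -sumrN; apply: eq_bigr => p _; rewrite !mxE big_ord1 !mxE !eqxx /=.
  rewrite !andbT -/(w p) ![j == _]eq_sym ![k == _]eq_sym.
  (* As j != k, the diagonal contributions of the edge at [p] drop out and only the two cross terms
     remain. *)
  have pjk : ~~ ((p == j) && (p == k)) by case: eqP => // ->.
  have Spjk : ~~ ((ordS p == j) && (ordS p == k)) by case: eqP => // ->.
  move: pjk Spjk; case: (p == j); case: (p == k); case: (ordS p == j);
    case: (ordS p == k) => //= _ _; ring.
rewrite big_split /= (bigD1 j) //= eqxx big1 => [|p /negPf-> //].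
by rewrite addr0 (bigD1 k) //= eqxx big1 ?addr0 // => p /negPf->.
Qed.

Lemma cycle_laplacian_in_S (R : realType) (n : nat) :
  (3 <= n)%N -> in_S (cycle_graph n) (cycle_laplacian R n).
Proof.
move=> n3; split.
  rewrite /cycle_laplacian raddf_sum /=; apply: eq_bigr => p _.
  by rewrite linearZ /= trmx_mul !raddfB /= !trmx_delta.
move=> j k jk; rewrite cycle_laplacianE // oppr_eq0 /= /cycle_rel jk /=.
have [<-|_] := eqVneq (ordS j) k => /=.
  by rewrite (negPf (ordS2_neq _ n3)) addr0 invr_eq0 ordS_natr_neq.
have [<-|_] := eqVneq (ordS k) j => /=; last by rewrite addr0 eqxx.
by rewrite add0r invr_eq0 ordS_natr_neq.
Qed.

Lemma mul_delta_sub (R : realType) (n : nat) (p q : 'I_n) (v : 'cV[R]_n) :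
  (delta_mx 0 p - delta_mx 0 q) *m v = row p v - row q v.
Proof. by rewrite mulmxBl -!rowE. Qed.

Lemma cycle_laplacian_const (R : realType) (n : nat) :
  cycle_laplacian R n *m const_mx 1 = 0 :> 'cV_n.
Proof.
rewrite mulmx_suml big1 // => p _.
by rewrite -scalemxAl -mulmxA mul_delta_sub !row_const subrr mulmx0 scaler0.
Qed.

(** Each weight cancels the increment of the vector along its edge, and what is left telescopes
    around the cycle. *)
Lemma cycle_laplacian_id (R : realType) (n : nat) : (3 <= n)%N ->
  cycle_laplacian R n *m (\col_(j < n) j%:R) = 0.
Proof.
move=> n3; rewrite mulmx_suml.
transitivity (\sum_(p < n) (delta_mx (ordS p) 0 - delta_mx p 0 : 'cV[R]_n)).
  apply: eq_bigr => p _; rewrite -scalemxAl -mulmxA mul_delta_sub.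
  have -> : row p (\col_(j < n) j%:R) - row (ordS p) (\col_(j < n) j%:R)
      = - ((ordS p)%:R - p%:R)%:M :> 'M[R]_1.
    by apply/matrixP => a b; rewrite !ord1 !mxE opprB.
  rewrite mulmxN mul_mx_scalar scalerN scalerA mulVf ?ordS_natr_neq //.
  by rewrite scale1r opprB.
by rewrite sumrB [X in _ - X](reindex_inj (@ordS_inj n)) subrr.
Qed.

Lemma rank_cycle_laplacian (R : realType) (n : nat) : (3 <= n)%N ->
  (\rank (cycle_laplacian R n) + 2 <= n)%N.
Proof.
move=> n3; pose K := row_mx (const_mx 1) (\col_(j < n) j%:R) : 'M[R]_(n, 1 + 1).
have : cycle_laplacian R n *m K = 0.
  by rewrite mul_mx_row cycle_laplacian_const cycle_laplacian_id ?row_mx0.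
move/mulmx0_rank_max; apply: leq_trans; rewrite leq_add2l -mxrank_tr.
suff /eqP-> : row_free K^T by [].
apply: inj_row_free => v.
rewrite -[v]hsubmxK tr_row_mx mul_row_col => /rowP vK.
(* Coordinate 0, where the second kernel vector vanishes, isolates the coefficient of the constant
   vector; coordinate 1 then gives the other coefficient. *)
have l0 : lsubmx v = 0.
  have n0 : (0 < n)%N by lia.
  apply/rowP => a; rewrite ord1; move: (vK (Ordinal n0)).
  by rewrite !mxE !big_ord1 !mxE mulr1 mulr0 addr0.
have r0 : rsubmx v = 0.
  have n1 : (1 < n)%N by lia.
  apply/rowP => a; rewrite ord1; move: (vK (Ordinal n1)).
  by rewrite l0 mul0mx add0r !mxE !big_ord1 !mxE mulr1.
by rewrite l0 r0 row_mx0.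
Qed.

Lemma in_S_add_diag (R : realType) (n : nat) (G : sgraph n) (i : 'I_n)
    (A : 'M[R]_n) : in_S G A -> in_S G (A + delta_mx i i).
Proof.
case=> Asym AG; split; first by rewrite linearD /= Asym trmx_delta.
move=> j k jk; suff -> : (A + delta_mx i i) j k = A j k by apply: AG.
rewrite !mxE; case: eqP => [ji|_]; last by rewrite addr0.
by move: jk; rewrite ji eq_sym => /negPf->; rewrite addr0.
Qed.

Lemma del_rc_add_diag (R : realType) (n : nat) (i : 'I_n) (A : 'M[R]_n) :
  del_rc i (A + delta_mx i i) = del_rc i A.
Proof.
apply/matrixP => j k.
by rewrite !mxE eq_sym (negPf (neq_lift i j)) addr0.
Qed.

(** The bounds close up: 2 <= null L <= null L(i) + 1 <= 2. *)
Lemma nullity_cycle_laplacian (R : realType) (n : nat) (i : 'I_n) :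
  (3 <= n)%N -> nullity (cycle_laplacian R n) = 2%N /\
    nullity (del_rc i (cycle_laplacian R n)) = 1%N.
Proof.
move=> n3; have := cycle_nullity_del_rc i n3 (cycle_laplacian_in_S R n3).
have := nullity_le_del_rc i (cycle_laplacian R n).
have := rank_cycle_laplacian R n3.
by rewrite (nullityE (cycle_laplacian R n)); lia.
Qed.

Lemma nullity_cycle_laplacian_add_diag (R : realType) (n : nat) (i : 'I_n) :
  (3 <= n)%N -> nullity (cycle_laplacian R n + delta_mx i i) = 1%N.
Proof.
move=> n3; have LG := cycle_laplacian_in_S R n3.
set L := cycle_laplacian R n in LG *.
(* A rank-one change keeps the nullity at least 1; the reverse bound comes next. *)
have le_rank : (\rank (L + delta_mx i i)%R <= \rank L + 1)%N.
  by have := mxrank_add L (delta_mx i i); rewrite mxrank_delta.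
have : (n <= \rank (L + delta_mx i i)%R + 1)%N.
  apply: (rank_ge_of_kernel_meet (C := delta_mx (ordS i) 0 : 'cV_n)) => u uL uC.
  have ui : u 0 i = 0.
    (* Pairing with the constant vector kills the Laplacian and leaves exactly the entry of [u] at
       [i]. *)
    move/(congr1 (mulmx^~ (const_mx 1 : 'cV_n))): uL.
    rewrite mul0mx -mulmxA mulmxDl cycle_laplacian_const add0r.
    rewrite -(mul_delta_mx (0 : 'I_1)) -mulmxA -rowE row_const mulmxA -colE.
    by move/rowP/(_ 0); rewrite !mxE big_ord1 !mxE mulr1.
  apply: (cycle_kernel_propagation (i := i) (s := i) n3 (in_S_add_diag i LG)).
  - by move=> j _; rewrite uL mxE.
  - exact: ui.
  - by move: uC; rewrite -colE => /rowP/(_ 0); rewrite !mxE.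
by have := rank_cycle_laplacian R n3; rewrite -/L nullityE; lia.
Qed.

End CycleNullity.

Theorem proposition4p4 (R : realType) (n : nat) (hn : 3 <= n) (i : 'I_n) :
  (forall k l : nat,
     (k, l) <> (0, 0) -> (k, l) <> (1, 0) -> (k, l) <> (0, 1) ->
     (allows_SNIP R (cycle_graph n) i (k, l) <->
        (k, l) = (1, 1) \/ (k, l) = (2, 1)))
  /\ (forall A : 'M[R]_n, in_S (cycle_graph n) A -> has_SNIP i A).
Proof.
split=> [k l n00 n10 n01|A]; last exact: cycle_SNIP.
split.
  case=> A [AG _ [Ak Al]].
  (* From l <= 1 and k <= l + 1 only five pairs survive, three of which are excluded by
     hypothesis. *)
  have := cycle_nullity_del_rc i hn AG; have := nullity_le_del_rc i A.
  rewrite Ak Al; case: l n00 n10 n01 {Al} => [|[|l]] //.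
    by case: k {Ak} => [|[|k]].
  by case: k {Ak} => [|[|[|k]]] //; [left | right].
have LG := cycle_laplacian_in_S R hn.
have [L2 L1] := nullity_cycle_laplacian R i hn.
case=> ->.
  have L'G := in_S_add_diag i LG.
  exists (cycle_laplacian R n + delta_mx i i)%R; split=> //.
    exact: cycle_SNIP.
  by rewrite nullity_cycle_laplacian_add_diag // del_rc_add_diag L1.
exists (cycle_laplacian R n); split=> //; first exact: cycle_SNIP.
by rewrite L2 L1.
Qed.
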